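(* For any fair-chores instance with two agents, there exists an allocation $\mathbf O=(O_1,O_2)$ that is simultaneously MMS and PROP1 and that, moreover, maximizes the egalitarian welfare among all allocations and satisfies $\mathsf{UW}(\mathbf O)\ge -1$.
   Context: A fair-chores instance with two agents consists of agents $N=\{1,2\}$, indivisible items $E=\{e_1,\dots,e_m\}$ placed on a path in this order, and for each agent $i$ an additive valuation $v_i$ (i.e. $v_i(S)=\sum_{e\in S}v_i(e)$) with $v_i(e)\le 0$ for all $e\in E$, normalized so that $v_i(\emptyset)=0$, $v_i(E)=-1$. A bundle is connected if it is a set of consecutive items (the empty set is allowed). An allocation $\mathbf A=(A_1,A_2)$ is a partition of $E$ into two disjoint connected (possibly empty) bundles, $A_i$ being given to agent $i$ (either agent's bundle may be the left one). Its utilitarian welfare is $\mathsf{UW}(\mathbf A)=v_1(A_1)+v_2(A_2)$ and its egalitarian welfare is $\mathsf{EW}(\mathbf A)=\min\{v_1(A_1),v_2(A_2)\}$. The maximin share of agent $i$ is $\mathsf{MMS}_i=\max_{(X_1,X_2)}\min\{v_i(X_1),v_i(X_2)\}$ over all partitions of $E$ into two connected (possibly empty) bundles. An allocation is MMS if $v_i(A_i)\ge\mathsf{MMS}_i$ for both $i$. An allocation is PROP1 if for each $i$, either $v_i(A_i)\ge-\frac12$, or there is $e\in A_i$ such that $A_i\setminus\{e\}$ is connected and $v_i(A_i\setminus\{e\})\ge-\frac12$. *)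

(* Defs.v *)
From mathcomp Require Import all_boot all_order all_algebra.

Set Implicit Arguments.
Unset Strict Implicit.
Unset Printing Implicit Defensive.

Import Order.TTheory GRing.Theory Num.Theory.

Local Open Scope ring_scope.

(* The items e_1, ..., e_m of the path are the ordinals 0, ..., m - 1 in this
   order; a bundle is a set of ordinals. *)
Section Bundles.

Variable m : nat.

(* [a = b] gives the empty bundle. *)
Definition connected (S : {set 'I_m}) : bool :=
  [exists a : 'I_m.+1, exists b : 'I_m.+1, S == [set e : 'I_m | a <= e < b]%N].

(* Also serves as the notion of allocation, [X.1] and [X.2] being the bundles
   of agents 1 and 2; either one may be the left one. *)
Definition connected_partition (X : {set 'I_m} * {set 'I_m}) : bool :=
  [&& X.1 :|: X.2 == [set: 'I_m], [disjoint X.1 & X.2],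
      connected X.1 & connected X.2].

Variable R : realFieldType.

Definition value (v : 'I_m -> R) (S : {set 'I_m}) : R := \sum_(e in S) v e.

Definition chores_valuation (v : 'I_m -> R) : Prop :=
  (forall e, v e <= 0) /\ value v [set: 'I_m] = -1.

Definition UW (v1 v2 : 'I_m -> R) (A : {set 'I_m} * {set 'I_m}) : R :=
  value v1 A.1 + value v2 A.2.

Definition EW (v1 v2 : 'I_m -> R) (A : {set 'I_m} * {set 'I_m}) : R :=
  Num.min (value v1 A.1) (value v2 A.2).

(* [EW v v X] is min {v(X_1), v(X_2)}. The default value of the iterated
   maximum is attained by the connected partition (E, empty), hence this is the
   maximum over all connected partitions. *)
Definition MMS (v : 'I_m -> R) : R :=
  \big[Num.max/EW v v ([set: 'I_m], set0)]_(X | connected_partition X) EW v v X.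

Definition is_MMS (v1 v2 : 'I_m -> R) (A : {set 'I_m} * {set 'I_m}) : Prop :=
  MMS v1 <= value v1 A.1 /\ MMS v2 <= value v2 A.2.

Definition PROP1_for (v : 'I_m -> R) (S : {set 'I_m}) : Prop :=
  - (1 / 2) <= value v S \/
  exists e, [/\ e \in S, connected (S :\ e) & - (1 / 2) <= value v (S :\ e)].

Definition is_PROP1 (v1 v2 : 'I_m -> R) (A : {set 'I_m} * {set 'I_m}) : Prop :=
  PROP1_for v1 A.1 /\ PROP1_for v2 A.2.

End Bundles.

(* Main.v *)
(** If a partition (A1, A2) has UW < -1, exchanging the bundles strictly
    increases EW, so every EW-optimum has UW >= -1. Cut-and-choose on an MMS
    partition of either agent shows that an EW-optimum is also MMS. For PROP1,
    at most one agent of an EW-optimum, say agent 1, is worth less than -1/2.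
    Move to agent 2 the item of A1 at the cut: if agent 1 is still below -1/2,
    then agent 2 is at least -1/2, as otherwise exchanging the two new bundles
    would beat the optimum. So the new partition is again EW-optimal, and the
    bundle of agent 1 shrinks. *)
Require Import Defs.
From mathcomp Require Import all_boot all_order all_algebra.
From mathcomp Require Import zify lra.
Import Order.TTheory GRing.Theory Num.Theory.
Local Open Scope ring_scope.

Section Connected.

Set Implicit Arguments.
Unset Strict Implicit.

Variable m : nat.
Implicit Types (S A B : {set 'I_m}) (X : {set 'I_m} * {set 'I_m}).

(** Natural-number endpoints and pointwise membership bring connectedness into the reach of
    [lia]. *)
Lemma connectedP S :
  reflect (exists a b, [/\ (a <= m)%N, (b <= m)%N &
                           forall e : 'I_m, (e \in S) = (a <= e < b)%N])
          (connected S).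
Proof.
apply: (iffP existsP) => [[a /existsP[b /eqP ->]]|[a [b [am bm Sab]]]].
  by exists a, b; split=> [||e]; rewrite ?inE // -ltnS.
exists (Ordinal (am : (a < m.+1)%N)); apply/existsP.
exists (Ordinal (bm : (b < m.+1)%N)).
by apply/eqP/setP => e; rewrite Sab inE.
Qed.

Lemma connected_partition_swap X :
  connected_partition (X.2, X.1) = connected_partition X.
Proof.
by rewrite /connected_partition /= setUC disjoint_sym (andbC (connected X.2)).
Qed.

Lemma connected_partition_full : connected_partition ([set: 'I_m], set0).
Proof.
apply/and4P; split; rewrite /= ?setU0 //.
- by rewrite disjoint_sym disjoints_subset sub0set.
- by apply/connectedP; exists 0, m; split=> // e; rewrite inE ltn_ord.
- by apply/connectedP; exists 0, 0; split=> // e; rewrite inE ltn0 andbF.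
Qed.

Lemma mem_connected_partition X e :
  connected_partition X -> (e \in X.2) = (e \notin X.1).
Proof.
case/and4P=> /eqP XT dX _ _.
have := in_setT e; rewrite -XT inE.
by have [/(disjointFr dX) ->|] := boolP (e \in X.1).
Qed.

(** The item to move is the one of [A] next to the cut: its last item if [A] starts the path, its
    first item if [A] ends it. *)
Lemma move_boundary_item A B :
    connected_partition (A, B) -> A != set0 ->
  exists2 e, e \in A & connected_partition (A :\ e, e |: B).
Proof.
move=> pAB /set0Pn[x Ax].
have BE y := mem_connected_partition y pAB.
have [e Ae [cA cB]] : exists2 e, e \in A &
    connected (A :\ e) /\ connected (e |: B); last first.
  exists e => //; apply/and4P; split=> //=.
    by apply/eqP/setP => y; rewrite !inE BE /=; case: eqP; case: (y \in A).
  rewrite disjoints_subset; apply/subsetP => y.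
  by rewrite !inE BE /= negb_or negbK.
case/and4P: pAB => _ _ /connectedP[a [b [am bm Aab]]].
case/connectedP=> c [d [cm dm Bcd]].
have := Ax; rewrite Aab => /andP[ax xb].
have [a0|a_gt0] := posnP a.
  have b1m : (b.-1 < m)%N by lia.
  exists (Ordinal b1m); first by rewrite Aab /=; lia.
  split; apply/connectedP; [exists 0, b.-1 | exists b.-1, m];
    split=> [||[y ym]]; rewrite ?inE ?BE -?val_eqE /= ?Aab /=; lia.
have am' : (a < m)%N by lia.
have [bE|b_neq] := eqVneq b m.
  exists (Ordinal am'); first by rewrite Aab /=; lia.
  split; apply/connectedP; [exists a.+1, m | exists 0, a.+1];
    split=> [||[y ym]]; rewrite ?inE ?BE -?val_eqE /= ?Aab /=; lia.
(* Otherwise [A] touches neither end, so both end items lie in [B]; then [B] contains everything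
   between them, including the item [a] of [A]. *)
have m0 : (0 < m)%N by lia.
have m1 : (m.-1 < m)%N by lia.
have := Bcd (Ordinal m0); have := Bcd (Ordinal m1); have := Bcd (Ordinal am').
rewrite !BE !Aab /=; lia.
Qed.

End Connected.

Section Optimum.

Set Implicit Arguments.
Unset Strict Implicit.

Variables (m : nat) (R : realFieldType).
Implicit Types (v : 'I_m -> R) (A B : {set 'I_m}).
Implicit Types (X O : {set 'I_m} * {set 'I_m}).

Definition EW_optimal v1 v2 O : Prop :=
  connected_partition O /\
  forall X, connected_partition X -> EW v1 v2 X <= EW v1 v2 O.

Lemma EW_optimal_exists v1 v2 : exists O, EW_optimal v1 v2 O.
Proof.
by have [O pO maxO] := arg_maxP (EW v1 v2) (connected_partition_full m); exists O.
Qed.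

Lemma EW_swap v1 v2 X : EW v2 v1 (X.2, X.1) = EW v1 v2 X.
Proof. exact: minC. Qed.

Lemma EW_optimal_swap v1 v2 O :
  EW_optimal v1 v2 O -> EW_optimal v2 v1 (O.2, O.1).
Proof.
move=> [pO maxO]; split=> [|X pX]; first by rewrite connected_partition_swap.
by rewrite EW_swap -EW_swap maxO // connected_partition_swap.
Qed.

Lemma value_partition v X : chores_valuation v -> connected_partition X ->
  value v X.1 + value v X.2 = -1.
Proof.
move=> [_ <-] /and4P[/eqP XT dX _ _].
by rewrite /value -XT -bigU //; apply: eq_bigl => e; rewrite in_setU.
Qed.

Lemma valueD1 v A e : e \in A -> value v A = v e + value v (A :\ e).
Proof. by move=> Ae; rewrite /value (big_setD1 e). Qed.

Variables v1 v2 : 'I_m -> R.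
Hypotheses (hv1 : chores_valuation v1) (hv2 : chores_valuation v2).

(** If $v_1(O_1)+v_2(O_2)<-1$, then $v_1(O_2)=-1-v_1(O_1)>v_2(O_2)$ and likewise
    $v_2(O_1)>v_1(O_1)$, so the exchange raises the minimum. *)
Lemma EW_optimal_UW O : EW_optimal v1 v2 O -> -1 <= UW v1 v2 O.
Proof.
move=> [pO maxO]; have := maxO (O.2, O.1); rewrite connected_partition_swap.
move=> /(_ pO); rewrite /EW /UW /=.
have := value_partition hv1 pO; have := value_partition hv2 pO.
by rewrite !minEle; do 2![case: ifP => /idP ?]; lra.
Qed.

(** Agent 2 takes her preferred bundle, worth at least $-1/2$ to her, whereas [EW v1 v1 X] is at
    most $-1/2$; agent 1 gets one of the two bundles that this minimum ranges over. *)
Lemma cut_and_choose X : connected_partition X ->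
  exists2 Y, connected_partition Y & EW v1 v1 X <= EW v1 v2 Y.
Proof.
move=> pX; have v1X := value_partition hv1 pX.
have v2X := value_partition hv2 pX.
have [le21|lt12] := leP (value v2 X.1) (value v2 X.2).
  by exists X => //; rewrite /EW !minEle; do 2![case: ifP => /idP ?]; lra.
exists (X.2, X.1); first by rewrite connected_partition_swap.
by rewrite /EW /= !minEle; do 2![case: ifP => /idP ?]; lra.
Qed.

Lemma MMS_le_EW_optimal O : EW_optimal v1 v2 O -> MMS v1 <= EW v1 v2 O.
Proof.
move=> [_ maxO].
have leO X : connected_partition X -> EW v1 v1 X <= EW v1 v2 O.
  by move=> /cut_and_choose[Y /maxO leYO] /le_trans; apply.
(* The goal left after [bigmax_le] concerns the default value of the maximum. *)
by apply: bigmax_le => //; apply/leO/connected_partition_full.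
Qed.

(** Keeping agent 1 below $-1/2$ in the conclusion lets [EW_optimal_UW] place agent 2 above $-1/2$,
    which settles PROP1 for agent 2. *)
Lemma EW_optimal_PROP1 O : EW_optimal v1 v2 O -> value v1 O.1 < - (1 / 2) ->
  exists O', [/\ EW_optimal v1 v2 O', value v1 O'.1 < - (1 / 2) &
                 PROP1_for v1 O'.1].
Proof.
have [n] := ubnP #|O.1|; elim: n O => // n IHn [A B] /= ltAn optO ltA.
have [pO maxO] := optO.
have A0 : A != set0.
  by apply: contraTneq ltA => ->; rewrite /value big_set0 -leNgt; lra.
have [e Ae pO'] := move_boundary_item pO A0.
have [geA'|ltA'] := lerP (- (1 / 2)) (value v1 (A :\ e)).
  exists (A, B); split=> //; right; exists e; split=> //.
  by case/and4P: pO'.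
have [sgn1 _] := hv1; have vA := valueD1 v1 Ae; have ve := sgn1 e.
apply: (IHn (A :\ e, e |: B)) => //=.
  by move: ltAn; rewrite (cardsD1 e A) Ae.
have v1T := value_partition hv1 pO'; have v2T := value_partition hv2 pO'.
have UWO := EW_optimal_UW optO.
(* It suffices that the move does not lower EW. Once agent 2 is known to be at least $-1/2$, the new
   minimum is agent 1's value, which losing the chore [e] cannot decrease. *)
split=> // X /maxO/le_trans; apply.
have := maxO (e |: B, A :\ e).
rewrite -connected_partition_swap => /(_ pO').
move: v1T v2T UWO; rewrite /UW /EW /=.
by rewrite !minEle; do 3![case: ifP => /idP ?]; lra.
Qed.

End Optimum.

Lemma EW_optimal_MMS {m : nat} {R : realFieldType} (v1 v2 : 'I_m -> R) O :
    chores_valuation v1 -> chores_valuation v2 -> EW_optimal v1 v2 O ->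
  is_MMS v1 v2 O.
Proof.
move=> hv1 hv2 optO; split.
  by apply: le_trans (MMS_le_EW_optimal hv1 hv2 optO) _; rewrite ge_min lexx.
apply: le_trans (MMS_le_EW_optimal hv2 hv1 (EW_optimal_swap optO)) _.
by rewrite ge_min lexx.
Qed.

Lemma EW_optimal_PROP1_exists {m : nat} {R : realFieldType}
    (v1 v2 : 'I_m -> R) :
    chores_valuation v1 -> chores_valuation v2 ->
  exists2 O, EW_optimal v1 v2 O & is_PROP1 v1 v2 O.
Proof.
move=> hv1 hv2; have [O optO] := EW_optimal_exists v1 v2.
have [ge1|lt1] := lerP (- (1 / 2)) (value v1 O.1); last first.
  have [O' [optO' lt1' prop1]] := EW_optimal_PROP1 hv1 hv2 optO lt1.
  exists O' => //; split=> //; left.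
  by have := EW_optimal_UW hv1 hv2 optO'; rewrite /UW; lra.
have [ge2|lt2] := lerP (- (1 / 2)) (value v2 O.2).
  by exists O => //; split; left.
(* With the agents' roles exchanged, agent 2's bundle comes first. *)
have [[B A] [optO' lt2' prop2]] :=
  EW_optimal_PROP1 hv2 hv1 (EW_optimal_swap optO) lt2.
exists (A, B); first exact: EW_optimal_swap optO'.
split=> //; left.
by have := EW_optimal_UW hv2 hv1 optO'; move: lt2'; rewrite /UW /=; lra.
Qed.

Theorem lemma25 (R : realFieldType) (m : nat) (v1 v2 : 'I_m -> R)
    (hv1 : chores_valuation v1) (hv2 : chores_valuation v2) :
  exists O : {set 'I_m} * {set 'I_m},
    [/\ connected_partition O,
        is_MMS v1 v2 O,
        is_PROP1 v1 v2 O,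
        forall A : {set 'I_m} * {set 'I_m},
          connected_partition A -> EW v1 v2 A <= EW v1 v2 O
      & -1 <= UW v1 v2 O].
Proof.
have [O optO prop1O] := EW_optimal_PROP1_exists hv1 hv2.
exists O; split=> //; try by case: optO.
- exact: EW_optimal_MMS.
- exact: EW_optimal_UW.
Qed.
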